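(* Let $T=[0,\infty)$. For every $u_0\in\mathcal V_{[0,1]}$ there exists a pair $(u,\beta)$, with $u:T\to\mathcal V_{[0,1]}$ and $\beta:T\to\mathcal V$, such that $u\in H^1_{loc}(T;\mathcal V)\cap C^{0,1}(T;\mathcal V)$, $u(0)=u_0$, and for a.e. $t\in T$ $$\varepsilon\frac{du}{dt}+\varepsilon\Delta u(t)+\tfrac12\mathbf 1-u(t)=\beta(t),\qquad\beta(t)\in\mathcal B(u(t)).$$
   Context: Let $G=(V,E)$ be a finite, undirected, simple, connected graph with symmetric weights $\omega_{ij}=\omega_{ji}$, $\omega_{ij}>0$ for $ij\in E$ and $\omega_{ij}=0$ for $ij\notin E$. Let $d_i=\sum_{j}\omega_{ij}>0$ be the degree of $i\in V$. Fix $r\in[0,1]$ and $\varepsilon>0$. Let $\mathcal V=\{u:V\to\mathbb R\}$ and, for $X\subseteq\mathbb R$, $\mathcal V_X=\{u:V\to X\}$; $\mathcal V$ carries the inner product $\langle u,v\rangle_{\mathcal V}=\sum_{i\in V}u_iv_id_i^r$ with norm $\|\cdot\|_{\mathcal V}$. $\mathbf 1\in\mathcal V$ is the constant function $1$. The graph Laplacian is $(\Delta u)_i=d_i^{-r}\sum_{j\in V}\omega_{ij}(u_i-u_j)$. For an open interval $T$, $H^1(T;\mathcal V)$ is the set of $u\in L^2(T;\mathcal V)$ with generalised (weak) time derivative $du/dt\in L^2(T;\mathcal V)$. For any interval $T$, $H^1_{loc}(T;\mathcal V)$ is the set of $u:T\to\mathcal V$ with $u\in H^1((a,b);\mathcal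 V)$ for all $a,b\in T$ with $a<b$. $C^{0,1}(T;\mathcal V)$ denotes the (globally) Lipschitz functions $T\to\mathcal V$. For $u\in\mathcal V_{[0,1]}$, $\mathcal B(u)$ is the set of $\alpha\in\mathcal V$ such that for each $i\in V$: $\alpha_i\ge0$ if $u_i=0$, $\alpha_i=0$ if $0<u_i<1$, and $\alpha_i\le0$ if $u_i=1$. *)

(* Defs.v *)
From HB Require Import structures.
From mathcomp Require Import all_boot all_order all_algebra.
From mathcomp Require Import all_classical all_reals all_analysis.
Set Implicit Arguments.
Unset Strict Implicit.
Unset Printing Implicit Defensive.
Import Order.TTheory GRing.Theory Num.Theory.
Import numFieldNormedType.Exports.
Local Open Scope classical_set_scope.
Local Open Scope ring_scope.

Definition degree (R : realType) (V : finType) (w : V -> V -> R) (i : V) : R :=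
  \sum_j w i j.

Record weighted_graph (R : realType) (V : finType)
    (E : rel V) (w : V -> V -> R) : Prop := WeightedGraph {
  edge_sym : symmetric E;
  edge_irrefl : irreflexive E;
  edge_connected : forall i j, connect E i j;
  weight_sym : forall i j, w i j = w j i;
  weight_edge : forall i j, E i j -> 0 < w i j;
  weight_nonedge : forall i j, ~~ E i j -> w i j = 0;
  degree_gt0 : forall i, 0 < degree w i }.

Section VertexFunctions.
Variables (R : realType) (V : finType) (w : V -> V -> R) (r : R).
Implicit Types (u v : V -> R).

Definition innerV u v : R := \sum_i u i * v i * degree w i `^ r.

Definition normV u : R := Num.sqrt (innerV u u).

Definition laplacian u (i : V) : R :=
  degree w i `^ (- r) * \sum_j w i j * (u i - u j).

End VertexFunctions.

Definition valued_in (R : realType) (V : finType) (X : set R) : set (V -> R) :=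
  [set u | forall i, X (u i)].

(* Only meaningful for u with values in [0, 1]. *)
Definition subdiffB (R : realType) (V : finType) (u : V -> R) : set (V -> R) :=
  [set alpha | forall i, [/\ u i = 0 -> 0 <= alpha i,
                             0 < u i < 1 -> alpha i = 0
                           & u i = 1 -> alpha i <= 0]].

(* A map from an interval T to V -> R is a total function on R of which only
   the restriction to T is ever considered. *)
Section TimeDependent.
Variables (R : realType) (V : finType) (w : V -> V -> R) (r : R).
Implicit Types (T : set R) (u v phi : R -> V -> R).
Local Notation mu := (@lebesgue_measure R).

(* Borel representatives; V being finite, measurability is componentwise. *)
Definition L2 T u : Prop :=
  (forall i, measurable_fun T (fun t => u t i)) /\
  (\int[mu]_(t in T) ((normV w r (u t) ^+ 2)%:E) < +oo)%E.

(* C_c^oo(T; V) for an open set T, extended by 0 outside T. *)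
Definition test_function T phi : Prop :=
  [/\ forall i n t, derivable (derive1n n (fun s => phi s i)) t 1,
      compact (closure [set t | exists i, phi t i <> 0])
    & closure [set t | exists i, phi t i <> 0] `<=` T].

Definition weak_derivative T u v : Prop :=
  forall phi, test_function T phi ->
    \int[mu]_(t in T)
       innerV w r (u t) (fun i => derive1 (fun s => phi s i) t) =
    - \int[mu]_(t in T) innerV w r (v t) (phi t).

Definition H1 T u : Prop :=
  L2 T u /\ exists v, L2 T v /\ weak_derivative T u v.

Definition H1_loc T u : Prop :=
  forall a b, T a -> T b -> a < b -> H1 `]a, b[ u.

(* v is the weak derivative du/dt of u in H^1_loc(T; V), unique up to null
   sets. *)
Definition weak_derivative_loc T u v : Prop :=
  forall a b, T a -> T b -> a < b ->
    L2 `]a, b[ v /\ weak_derivative `]a, b[ u v.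

Definition lipschitzV T u : Prop :=
  exists L : R, forall s t, T s -> T t ->
    normV w r (fun i => u s i - u t i) <= L * `|s - t|.

End TimeDependent.

(* Main.v *)
Require Import Defs.
From HB Require Import structures.
From mathcomp Require Import all_boot all_order all_algebra.
From mathcomp Require Import all_classical all_reals all_analysis.
From mathcomp Require Import measurable_realfun ring lra.
Set Implicit Arguments.
Unset Strict Implicit.
Unset Printing Implicit Defensive.
Import Order.TTheory GRing.Theory Num.Theory.
Import numFieldNormedType.Exports.
Local Open Scope classical_set_scope.
Local Open Scope ring_scope.

(** The inclusion says that u follows the affine field
    F(u) = (u - 1/2) / eps - Laplacian(u) on the cube [0, 1]^V, with the
    outward part of the velocity removed on the faces. Since the constraint is
    a product of intervals, every component can be treated as a scalar
    obstacle problem dx/dt = f on [0, 1].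

    Existence comes from the projected Euler scheme
    e(k+1) = clip (e(k) + h F(e(k))). For it one has a purely one-dimensional
    comparison ([clip_iter_le], [clip_iter_ge]): if f <= M along the way, then
    x grows at speed at most M or sits at 0, and symmetrically from below.
    As F is Lipschitz and the scheme moves at bounded speed, this yields
    inequalities between two times s <= t in which only the value of F at s
    appears ([euler_upper], [euler_lower]). They involve finitely many values
    of the scheme, so they survive a pointwise limit; taking that limit along
    an ultrafilter of step sizes spares any convergence estimate
    ([projected_flow_exists]). The resulting two-sided estimate is the
    predicate [reflected_path].

    Such a path x with speed f satisfies, for t > 0: x'(t) = f(t) when
    0 < x(t) < 1 ([path_derive_interior]), f(t) <= 0 when x(t) = 0
    ([path_at0]), and f(t) >= 0 when x(t) = 1 ([path_at1]). So the candidate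
    for the time derivative is f where 0 < x < 1 and 0 elsewhere
    ([path_speed]), and beta = eps (du - F(u)) then has the sign that B(u)
    prescribes at every positive time.

    That [path_speed] is the weak derivative of x needs no almost everywhere
    differentiability of Lipschitz functions. Let phi be a polynomial whose
    derivative vanishes at 0 and 1. Then phi o x is differentiable at every
    t > 0, with the continuous derivative phi'(x) f: at a contact time
    phi varies to second order only, while x is Lipschitz
    ([path_derive_comp]). The fundamental theorem of calculus applies to
    phi(x) times a test function. Letting phi run through polynomials that
    converge to the identity, with derivatives bounded and converging to 1 on
    ]0, 1[ ([flat_ends]), dominated convergence gives the claim
    ([path_weak_derivative]). *)

(** * The projected Euler scheme *)

Definition clip (R : realType) (x : R) : R := Num.min 1 (Num.max 0 x).

Lemma clip_ge0 (R : realType) (x : R) : 0 <= clip x.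
Proof. by rewrite /clip le_min ler01 le_max lexx. Qed.

Lemma clip_le1 (R : realType) (x : R) : clip x <= 1.
Proof. by rewrite /clip ge_min lexx. Qed.

Lemma clip_le (R : realType) (x : R) : clip x <= Num.max 0 x.
Proof. by rewrite /clip ge_min lexx orbT. Qed.

(** The reflection y -> 1 - y exchanges the two obstacles; it turns every
    statement about the lower obstacle into one about the upper obstacle. *)
Lemma clip_sym (R : realType) (x : R) : clip (1 - x) = 1 - clip x.
Proof.
rewrite /clip; case: (leP 0 (1 - x)) => ?; case: (leP 0 x) => ?;
  by do ![case: leP => ?]; lra.
Qed.

Lemma dist_clip_le (R : realType) (x y : R) :
  0 <= y <= 1 -> `|clip x - y| <= `|x - y|.
Proof.
move=> /andP[y0 y1]; rewrite /clip.
by case: (leP 0 x) => ?; rewrite ?(min_r ler01); first case: (leP 1 x) => ?;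
  rewrite ler_norml; case: (ger0P (x - y)) => ?; apply/andP; split; lra.
Qed.

(** The maximum with 0 is needed because, when M < 0, the scheme is pushed
    against the lower obstacle and stays there; when M >= 0 the right-hand
    side is the unconstrained bound, as [x j >= 0]. *)
Lemma clip_iter_le (R : realType) (h M : R) (x f : nat -> R) (j n : nat) :
  0 <= h -> 0 <= x j -> (forall k, x k.+1 = clip (x k + h * f k)) ->
  (forall k, (k < n)%N -> f (j + k)%N <= M) ->
  x (j + n)%N <= Num.max 0 (x j + n%:R * h * M).
Proof.
move=> h0 xj0 step; elim: n => [|n IH] fM.
  by rewrite addn0 !mul0r addr0 le_max lexx orbT.
have {}IH := IH (fun k kn => fM k (ltnW kn)).
rewrite addnS step (le_trans (clip_le _))// ge_max le_max lexx/=.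
have hf : h * f (j + n)%N <= h * M by rewrite ler_wpM2l// fM.
rewrite -natr1 mulrDl mul1r mulrDl.
move: IH; rewrite !le_max => /orP[xn|xn]; last by apply/orP; right; lra.
have [hM|hM] := leP (h * M) 0; first by apply/orP; left; lra.
apply/orP; right.
have : 0 <= n%:R * h * M by rewrite -mulrA mulr_ge0// ltW.
lra.
Qed.

Lemma clip_iter_ge (R : realType) (h m : R) (x f : nat -> R) (j n : nat) :
  0 <= h -> x j <= 1 -> (forall k, x k.+1 = clip (x k + h * f k)) ->
  (forall k, (k < n)%N -> m <= f (j + k)%N) ->
  Num.min 1 (x j + n%:R * h * m) <= x (j + n)%N.
Proof.
move=> h0 xj1 step fm.
have := @clip_iter_le _ h (- m) (fun k => 1 - x k) (fun k => - f k) j n h0.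
have step' k : 1 - x k.+1 = clip (1 - x k + h * - f k).
  by rewrite step -clip_sym; congr clip; ring.
rewrite subr_ge0 => /(_ xj1 step').
have nfm k : (k < n)%N -> - f (j + k)%N <= - m by move=> /fm; rewrite lerN2.
move=> /(_ nfm); rewrite le_max ge_min => /orP[|] ?; apply/orP; [left|right]; lra.
Qed.

Fixpoint euler (R : realType) (V : finType) (F : (V -> R) -> V -> R) (h : R)
    (u0 : V -> R) (k : nat) : V -> R :=
  if k is k'.+1 then
    let u := euler F h u0 k' in fun i => clip (u i + h * F u i)
  else u0.

Section Euler.
Context (R : realType) (V : finType) (F : (V -> R) -> V -> R) (B K : R).
Hypothesis F_bounded : forall u, valued_in `[0, 1] u -> forall i, `|F u i| <= B.
Hypothesis K_ge0 : 0 <= K.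
Hypothesis F_lip : forall u v i, `|F u i - F v i| <= K * \sum_j `|u j - v j|.
Variables (h : R) (u0 : V -> R).
Hypothesis h_ge0 : 0 <= h.
Hypothesis u0_01 : valued_in `[0, 1] u0.
Local Notation e := (euler F h u0).
Local Notation C := (K * #|V|%:R * B).

Lemma euler_01 k : valued_in `[0, 1] (e k).
Proof.
case: k => [|k] i //=; first exact: u0_01.
by rewrite in_itv/= clip_ge0 clip_le1.
Qed.

Lemma euler_01E k i : 0 <= e k i <= 1.
Proof. by have := euler_01 k i; rewrite /= in_itv. Qed.

Lemma euler_lip j n i : `|e (j + n)%N i - e j i| <= B * (n%:R * h).
Proof.
elim: n => [|n IH]; first by rewrite addn0 subrr normr0 mul0r mulr0.
rewrite addnS -natr1 /=; set x := euler _ _ _ _.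
have x01 : 0 <= x i <= 1 by exact: euler_01E.
have := dist_clip_le (x i + h * F x i) x01.
rewrite addrAC subrr add0r normrM (ger0_norm h_ge0) => step.
have hF : h * `|F x i| <= h * B.
  by apply: ler_wpM2l => //; apply: F_bounded; exact: euler_01.
have := ler_distD (x i) (clip (x i + h * F x i)) (e j i).
rewrite -/x in IH; lra.
Qed.

Lemma euler_field_near j n k i : (k <= n)%N ->
  `|F (e (j + k)%N) i - F (e j) i| <= C * (n%:R * h).
Proof.
move=> kn; apply: (le_trans (F_lip _ _ _)).
have : \sum_l `|e (j + k)%N l - e j l| <= \sum_(l : V) B * (n%:R * h).
  apply: ler_sum => l _; apply: (le_trans (euler_lip _ _ _)).
  apply: ler_wpM2l; last by rewrite ler_wpM2r// ler_nat.
  by apply: le_trans (F_bounded u0_01 l).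
rewrite sumr_const -mulr_natl => /(ler_wpM2l K_ge0); lra.
Qed.

(** Freezing F at the initial index costs an error of second order in the
    elapsed time [n%:R * h], because the scheme moves at speed at most [B]. *)
Lemma euler_upper j n i : e (j + n)%N i <=
  Num.max 0 (e j i + n%:R * h * (F (e j) i + C * (n%:R * h))).
Proof.
apply: (@clip_iter_le _ h _ (e ^~ i) (fun k => F (e k) i)) => //.
  by have /andP[] := euler_01E j i.
move=> k /ltnW kn; have := euler_field_near j i kn.
by rewrite ler_norml => /andP[_]; lra.
Qed.

Lemma euler_lower j n i :
  Num.min 1 (e j i + n%:R * h * (F (e j) i - C * (n%:R * h))) <= e (j + n)%N i.
Proof.
apply: (@clip_iter_ge _ h _ (e ^~ i) (fun k => F (e k) i)) => //.
  by have /andP[] := euler_01E j i.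
move=> k /ltnW kn; have := euler_field_near j i kn.
by rewrite ler_norml => /andP[+ _]; lra.
Qed.

End Euler.

(** * Passing to the limit *)

(** Compactness in the form that lets one ultrafilter of step sizes make all
    components converge at all times simultaneously. *)
Lemma ultra_cvg_segment (R : realType) (T : Type) (U : set_system T)
    (x : T -> R) (a b : R) : UltraFilter U ->
  (forall n, a <= x n <= b) -> exists l : R, x n @[n --> U] --> l.
Proof.
move=> ultraU x01.
have : (x n @[n --> U]) `[a, b]%classic.
  by apply: (@filterE _ U) => n /=; rewrite in_itv/=; exact: x01.
case/(@segment_compact R a b (x n @[n --> U]) _) => l [_ xl]; exists l => A lA.
case: (in_ultra_setVsetC (x @^-1` A) ultraU) => // UxA.
by have [y [nAy Ay]] := xl (~` A) A UxA lA.
Qed.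

(** Under [0 < la] the alternative [a n <= 0] is eventually excluded. *)
Lemma le_cvg_pos (R : realType) (T : topologicalType) (U : set_system T)
    (a b : T -> R) (la lb : R) : ProperFilter U ->
  a n @[n --> U] --> la -> b n @[n --> U] --> lb -> (forall n, a n <= Num.max 0 (b n)) ->
  0 < la -> la <= lb.
Proof.
move=> pU ala blb ab la0; apply: (ler_cvg_to ala blb).
have : \forall n \near U, 0 < a n by exact: (cvgr_gt la).
apply: filterS => n an0; move: (ab n); rewrite le_max => /orP[|//].
by rewrite leNgt an0.
Qed.

Lemma ge_cvg_lt1 (R : realType) (T : topologicalType) (U : set_system T)
    (a b : T -> R) (la lb : R) : ProperFilter U ->
  a n @[n --> U] --> la -> b n @[n --> U] --> lb -> (forall n, Num.min 1 (b n) <= a n) ->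
  la < 1 -> lb <= la.
Proof.
move=> pU ala blb ab la0; apply: (ler_cvg_to blb ala).
have : \forall n \near U, a n < 1 by exact: (cvgr_lt la).
apply: filterS => n an0; move: (ab n); rewrite ge_min => /orP[|//].
by rewrite leNgt an0.
Qed.

Lemma cvg_mesh (R : realType) (t : R) : 0 <= t ->
  (Num.truncn (n.+1%:R * t))%:R * (n.+1%:R)^-1 @[n --> \oo] --> t.
Proof.
move=> t0.
have lim0 : t - harmonic n @[n --> \oo] --> t.
  by rewrite -[X in _ --> X]subr0; apply: cvgB; [exact: cvg_cst|exact: cvg_harmonic].
apply: (squeeze_cvgr _ lim0 (cvg_cst t)).
apply: nearW => n; rewrite /harmonic/=.
have n0 : (0 : R) < n.+1%:R by rewrite ltr0n.
have nt0 : 0 <= n.+1%:R * t by rewrite mulr_ge0// ltW.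
have /andP[lo up] := truncn_itv nt0.
rewrite ler_pdivrMr// (mulrC t) lo andbT ler_pdivlMr// mulrBl mulVf ?gt_eqF//.
by move: up; rewrite -natr1; lra.
Qed.

(** The trace that the obstacle problem dx/dt = f on [0, 1] leaves in closed
    inequalities: off the lower obstacle, x cannot have grown faster than f
    allows, and off the upper obstacle it cannot have grown more slowly. The
    terms in C absorb the variation of f between s and t, so that each
    inequality involves only two times and is stable under pointwise
    limits. *)
Record reflected_path (R : realType) (C : R) (x f : R -> R) : Prop := ReflectedPath {
  path_01 : forall t, 0 <= x t <= 1;
  path_upper : forall s t, 0 <= s -> s <= t -> 0 < x t ->
    x t <= x s + (t - s) * (f s + C * (t - s));
  path_lower : forall s t, 0 <= s -> s <= t -> x t < 1 ->
    x s + (t - s) * (f s - C * (t - s)) <= x t }.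

(** The limit of projected Euler schemes along an ultrafilter of step sizes
    1 / (n + 1). Negative times are sent to the initial value, which makes the
    flow Lipschitz, hence continuous, on the whole line. *)
Lemma projected_flow_exists (R : realType) (V : finType)
    (F : (V -> R) -> V -> R) (B K : R) (u0 : V -> R) :
  (forall u, valued_in `[0, 1] u -> forall i, `|F u i| <= B) ->
  0 <= K -> (forall u v i, `|F u i - F v i| <= K * \sum_j `|u j - v j|) ->
  valued_in `[0, 1] u0 ->
  exists u : R -> V -> R,
    [/\ u 0 = u0,
        forall i s t, `|u t i - u s i| <= B * `|t - s|
      & forall i, reflected_path (K * #|V|%:R * B)
                    (fun t => u t i) (fun t => F (u t) i)].
Proof.
move=> FB K0 FK u01.
have [U [ultraU ooU]] := ultraFilterLemma (@eventually_filter).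
pose h n : R := n.+1%:R^-1.
have h0 n : 0 <= h n by rewrite /h invr_ge0.
pose k (t : R) n := Num.truncn (n.+1%:R * t).
pose e n := euler F (h n) u0.
have e01 n m i := euler_01E F (h n) u01 m i.
have /choice[u ulim] t : exists ut : V -> R, forall i, e n (k t n) i @[n --> U] --> ut i.
  have /choice[ut utlim] i : exists l : R, e n (k t n) i @[n --> U] --> l.
    by apply: (ultra_cvg_segment (a := 0) (b := 1) ultraU) => n; exact: e01.
  by exists ut.
have Flim t i : F (e n (k t n)) i @[n --> U] --> F (u t) i.
  apply/cvgrPdist_le => d d0.
  have sum0 : \sum_j `|u t j - e n (k t n) j| @[n --> U] --> \sum_(j : V) (0 : R).
    apply: cvg_big => [|j _]; first exact: (@add_continuous R).
    rewrite -(normr0 R) -(subrr (u t j)).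
    by apply: cvg_norm; apply: cvgB; [exact: cvg_cst|exact: ulim].
  have {sum0} : K * \sum_j `|u t j - e n (k t n) j| @[n --> U] --> K * \sum_(j : V) (0 : R).
    by apply: cvgM; first exact: cvg_cst.
  rewrite big1// mulr0.
  move/cvgrPdist_le => /(_ d d0).
  apply: filterS => n; rewrite sub0r normrN => /ler_normlW.
  exact: le_trans (FK _ _ _).
have klim t : 0 <= t -> (k t n)%:R * h n @[n --> U] --> t.
  by move=> t0; apply: (cvg_trans _ (cvg_mesh t0)) => A; exact: ooU.
have dlim s t : 0 <= s -> s <= t -> (k t n - k s n)%:R * h n @[n --> U] --> t - s.
  move=> s0 st.
  have -> : (fun n => (k t n - k s n)%:R * h n) =
            (fun n => (k t n)%:R * h n - (k s n)%:R * h n).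
    apply/funext => n; rewrite natrB ?mulrBl// /k.
    by apply: le_truncn; rewrite ler_wpM2l.
  by apply: cvgB; apply: klim => //; exact: le_trans st.
have ks s t n : s <= t -> (k s n + (k t n - k s n) = k t n)%N.
  by move=> st; rewrite subnKC// /k; apply: le_truncn; rewrite ler_wpM2l.
have u0E : u 0 = u0.
  apply/funext => i; apply: (@cvg_unique _ (@Rhausdorff R) _ _ _ _ (ulim 0 i)).
  by apply: cvg_near_cst; apply: nearW => n; rewrite /k mulr0 truncn0.
have ulip i s t : 0 <= s -> s <= t -> `|u t i - u s i| <= B * (t - s).
  move=> s0 st.
  have lim1 : `|e n (k t n) i - e n (k s n) i| @[n --> U] --> `|u t i - u s i|.
    by apply: cvg_norm; apply: cvgB; exact: ulim.
  have lim2 : B * ((k t n - k s n)%:R * h n) @[n --> U] --> B * (t - s).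
    by apply: cvgM; [exact: cvg_cst|exact: dlim].
  apply: (ler_cvg_to lim1 lim2); apply: nearW => n.
  rewrite -{1}(ks s t n st); exact: euler_lip.
have path i : reflected_path (K * #|V|%:R * B) (fun t => u t i) (fun t => F (u t) i).
  split.
  - move=> t; apply/andP; split.
      apply: (ler_cvg_to (cvg_cst (0 : R)) (ulim t i)); apply: nearW => n.
      by case/andP : (e01 n (k t n) i).
    apply: (ler_cvg_to (ulim t i) (cvg_cst (1 : R))); apply: nearW => n.
    by case/andP : (e01 n (k t n) i).
  - move=> s t s0 st /=; apply: (le_cvg_pos _ (ulim t i)); last first.
      by move=> n; rewrite -{1}(ks s t n st); exact: (euler_upper FB K0 FK (h0 n) u01).
    apply: cvgD; first exact: ulim.
    apply: cvgM; first exact: dlim.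
    apply: cvgD; first exact: Flim.
    by apply: cvgM; [exact: cvg_cst|exact: dlim].
  - move=> s t s0 st /=; apply: (ge_cvg_lt1 _ (ulim t i)); last first.
      by move=> n; rewrite -{1}(ks s t n st); exact: (euler_lower FB K0 FK (h0 n) u01).
    apply: cvgD; first exact: ulim.
    apply: cvgM; first exact: dlim.
    apply: cvgB; first exact: Flim.
    by apply: cvgM; [exact: cvg_cst|exact: dlim].
exists (fun t => u (Num.max 0 t)); split.
- by rewrite max_l.
- move=> i s t.
  have lip_max p q : p <= q ->
      `|u (Num.max 0 q) i - u (Num.max 0 p) i| <= B * (q - p).
    move=> pq; have pq' : Num.max 0 p <= Num.max 0 q by rewrite ge_max !le_max lexx pq orbT.
    apply: (le_trans (ulip _ _ _ _ pq')); first by rewrite le_max lexx.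
    apply: ler_wpM2l; first exact: le_trans (FB _ u01 i).
    by move: pq'; case: (leP 0 p) => ?; case: (leP 0 q) => ? ?; lra.
  have [st|/ltW ts] := leP s t.
    by rewrite [`|t - s|]ger0_norm ?subr_ge0//; exact: lip_max.
  by rewrite /= distrC (distrC t) [`|s - t|]ger0_norm ?subr_ge0//; exact: lip_max.
move=> i; have [p01 pup plo] := path i; split.
- by move=> t; exact: p01.
- move=> s t s0 st; have t0 := le_trans s0 st.
  by rewrite !max_r//; exact: pup.
- move=> s t s0 st; have t0 := le_trans s0 st.
  by rewrite !max_r//; exact: plo.
Qed.

(** * Differentiability and contact conditions *)

Lemma is_derive1_near (R : realType) (g : R -> R) (t d : R) :
  is_derive t 1 g d <->
  forall eta, 0 < eta ->
    \forall s \near t, `|g s - g t - d * (s - t)| <= eta * `|s - t|.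
Proof.
have quot (h eta : R) : h != 0 ->
    (`|d - h^-1 *: (g (h *: 1 + t) - g t)| <= eta) =
    (`|g (t + h) - g t - d * (t + h - t)| <= eta * `|h|).
  move=> h0; rewrite -[RHS](@ler_pM2r _ `|h|^-1) ?invr_gt0 ?normr_gt0//.
  rewrite mulfK ?normr_eq0// -normfV -normrM -[in RHS]normrN; congr (`|_| <= _).
  by rewrite /GRing.scale/= mulr1 (addrC h); field.
split=> [[dg dE] eta eta0|gP].
  have /cvgrPdist_le/(_ eta eta0) lim : h^-1 *: (g (h *: 1 + t) - g t) @[h --> 0^'] --> d.
    by rewrite -dE; exact: dg.
  apply/nbhs0P.
  have {}lim : \forall h \near (0 : R), h != 0 ->
    `|d - h^-1 *: (g (h *: 1 + t) - g t)| <= eta by exact: lim.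
  apply: filterS lim => h; have [->|h0] := eqVneq h 0.
    by rewrite addr0 !subrr mulr0 subr0 normr0 mulr0.
  by move=> /(_ isT); rewrite quot// [t + h - t]addrAC subrr add0r.
have lim : h^-1 *: (g (h *: 1 + t) - g t) @[h --> 0^'] --> d.
  apply/cvgrPdist_le => eta eta0.
  have /nbhs0P gh := gP eta eta0.
  suff : \forall h \near (0 : R), h != 0 ->
    `|d - h^-1 *: (g (h *: 1 + t) - g t)| <= eta by [].
  apply: filterS gh => h + h0.
  by rewrite [X in _ * `|X|]addrAC subrr add0r quot.
by apply: DeriveDef; [apply/cvg_ex; exists d|exact/cvg_lim].
Qed.

Lemma near_dist_le (R : realType) (t eta : R) :
  0 < eta -> \forall s \near t, `|t - s| <= eta.
Proof. by move=> eta0; apply/nbhs_ballP; exists eta => //= s /ltW. Qed.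

Section ReflectedPath.
Context (R : realType) (C B : R) (x f : R -> R).
Hypothesis C_ge0 : 0 <= C.
Hypothesis xf : reflected_path C x f.
Hypothesis x_lip : forall s t, `|x t - x s| <= B * `|t - s|.
Hypothesis f_cont : continuous f.

Lemma lip_bound_ge0 : 0 <= B.
Proof. by have := x_lip 0 1; rewrite subr0 normr1 mulr1; exact: le_trans. Qed.

Lemma path_continuous : continuous x.
Proof.
move=> t; apply/cvgrPdist_le => eta eta0.
have B1 : 0 < B + 1 by rewrite ltr_wpDl// lip_bound_ge0.
have : \forall s \near t, `|t - s| <= eta / (B + 1).
  by apply: near_dist_le; rewrite divr_gt0.
apply: filterS => s; rewrite ler_pdivlMr// => ts; apply: (le_trans (x_lip s t)).
by apply: le_trans ts; rewrite mulrC ler_wpM2l// lerDl.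
Qed.

(** Near such a t the path touches neither obstacle, so both estimates of
    [reflected_path] apply; they pinch the increment around f(t) (s - t) up to
    C (s - t)^2 and the oscillation of f. For s < t the roles of s and t
    are exchanged, and f is evaluated at s. *)
Lemma path_derive_interior t : 0 < t -> 0 < x t < 1 -> is_derive t 1 x (f t).
Proof.
move=> t0 /andP[x0 x1]; apply/is_derive1_near => eta eta0.
have eta2 : 0 < eta / 2 by rewrite divr_gt0.
have Cd : 0 < eta / 2 / (C + 1) by rewrite divr_gt0// ltr_wpDl.
near=> s.
have s0 : 0 < s by near: s; exact: lt_nbhsr.
have xs0 : 0 < x s by near: s; apply: (cvgr_gt (x t)) => //; exact: path_continuous.
have xs1 : x s < 1 by near: s; apply: (cvgr_lt (x t)) => //; exact: path_continuous.
have fs : `|f t - f s| <= eta / 2 by near: s; apply: cvgr_dist_le => //; exact: f_cont.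
have Cs : C * `|t - s| <= eta / 2.
  have : `|t - s| <= eta / 2 / (C + 1) by near: s; exact: near_dist_le.
  rewrite ler_pdivlMr ?ltr_wpDl// mulrC; apply: le_trans.
  by rewrite ler_wpM2r// lerDl.
have [ts|/ltW st] := leP t s.
  rewrite distrC ger0_norm ?subr_ge0// in Cs.
  have D0 : 0 <= s - t by rewrite subr_ge0.
  have up := path_upper xf (ltW t0) ts xs0.
  have lo := path_lower xf (ltW t0) ts xs1.
  have DC := ler_wpM2l D0 Cs; rewrite [`|s - t|]ger0_norm// ler_norml.
  by apply/andP; split; nra.
rewrite ger0_norm ?subr_ge0// in Cs.
have D0 : 0 <= t - s by rewrite subr_ge0.
have up := path_upper xf (ltW s0) st x0.
have lo := path_lower xf (ltW s0) st x1.
have DC := ler_wpM2l D0 Cs.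
move: fs; rewrite ler_norml => /andP[/(ler_wpM2l D0) fs1 /(ler_wpM2l D0) fs2].
rewrite [`|s - t|]distrC [`|t - s|]ger0_norm// ler_norml.
by apply/andP; split; nra.
Unshelve. all: by end_near.
Qed.

(** If f(t) > 0, then f is positive shortly before t, so the path, starting
    from a nonnegative value, would be positive at time t. *)
Lemma path_at0 t : 0 < t -> x t = 0 -> f t <= 0.
Proof.
move=> t0 xt; rewrite leNgt; apply/negP => ft.
have Cd : 0 < f t / (C + 1) by rewrite divr_gt0// ltr_wpDl.
have : \forall s \near t^'-, False; last first.
  by move=> /filter_ex[].
near=> s.
have st : s < t by near: s; exact: nbhs_left_lt.
have s0 : 0 < s by near: s; exact: nbhs_left_gt.
have ft2 : 0 < f t / 2 by rewrite divr_gt0.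
have Cd2 : 0 < f t / 2 / (C + 1) by rewrite divr_gt0// ltr_wpDl.
have fs : f t / 2 < f s.
  near: s; apply: (cvgr_gt (f t)); last by lra.
  by apply: cvg_at_left_filter; exact: f_cont.
have Cs : C * (t - s) <= f t / 2.
  have : t - s < f t / 2 / (C + 1).
    have : t - f t / 2 / (C + 1) < s by near: s; apply: nbhs_left_gt; lra.
    lra.
  rewrite ltr_pdivlMr ?ltr_wpDl// mulrC => /ltW; apply: le_trans.
  by apply: ler_wpM2r; [rewrite subr_ge0 ltW|rewrite lerDl].
have xt1 : x t < 1 by rewrite xt.
have := path_lower xf (ltW s0) (ltW st) xt1.
have /andP[xs0 _] := path_01 xf s.
have : 0 < (t - s) * (f s - C * (t - s)) by rewrite mulr_gt0 ?subr_gt0//; lra.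
by rewrite xt; lra.
Unshelve. all: by end_near.
Qed.

End ReflectedPath.

Lemma reflected_path_sym (R : realType) (C : R) (x f : R -> R) :
  reflected_path C x f -> reflected_path C (fun t => 1 - x t) (fun t => - f t).
Proof.
move=> [x01 up lo]; split=> [t|s t s0 st xt|s t s0 st xt].
- by have := x01 t; lra.
- by have := lo s t s0 st; rewrite -subr_gt0 => /(_ xt); lra.
- by have := up s t s0 st; (have -> : 0 < x t by lra) => /(_ isT); lra.
Qed.

Lemma path_at1 (R : realType) (C : R) (x f : R -> R) (t : R) : 0 <= C ->
  reflected_path C x f -> continuous f -> 0 < t -> x t = 1 -> 0 <= f t.
Proof.
move=> C0 xf fc t0 xt; rewrite -oppr_le0.
apply: (path_at0 C0 (reflected_path_sym xf) _ t0); last by rewrite xt subrr.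
by move=> s; apply: cvgN; exact: fc.
Qed.

(** At a contact time x need not be differentiable, but phi(x(s)) - phi(x(t))
    is o(|x(s) - x(t)|) = o(|s - t|) since phi' vanishes there. *)
Lemma path_derive_comp (R : realType) (C B : R) (x f phi : R -> R) (t d : R) :
  0 <= C -> reflected_path C x f ->
  (forall s t, `|x t - x s| <= B * `|t - s|) -> continuous f ->
  0 < t -> is_derive (x t) 1 phi d -> (x t = 0 \/ x t = 1 -> d = 0) ->
  is_derive t 1 (phi \o x) (d * f t).
Proof.
move=> C0 xf x_lip fc t0 phid d0.
have /andP[x0 x1] := path_01 xf t.
have [bd|[xt0 xt1]] : (x t = 0 \/ x t = 1) \/ x t != 0 /\ x t != 1.
- have [|xt0] := eqVneq (x t) 0; first by left; left.
  by have [|xt1] := eqVneq (x t) 1; [left; right|right].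
- have B0 := lip_bound_ge0 x_lip.
  have B1 : 0 < B + 1 by rewrite ltr_wpDl.
  move: phid; rewrite (d0 bd) mul0r => /is_derive1_near phid.
  apply/is_derive1_near => eta eta0.
  have etaB : 0 < eta / (B + 1) by rewrite divr_gt0.
  have : \forall s \near t, _ := path_continuous x_lip (phid _ etaB).
  apply: filterS => s /=.
  rewrite !mul0r !subr0 => phis; apply: (le_trans phis).
  rewrite -mulrA; apply: ler_wpM2l; first exact: ltW.
  rewrite ler_pdivrMl//; apply: (le_trans (x_lip t s)).
  by apply: ler_wpM2r => //; rewrite lerDl.
- apply: is_derive1_comp; apply: (path_derive_interior C0 xf x_lip fc t0).
  by rewrite !lt_neqAle x0 x1 xt1 eq_sym xt0.
Qed.

(** * Polynomials with vanishing derivative at 0 and 1 *)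

(** A primitive of 1 - (1 - y)^(n+1) - y^(n+1), which vanishes at 0 and 1 and
    tends to 1 in between; it converges to the identity on [0, 1]. *)
Definition flat_ends (R : realType) (n : nat) (y : R) : R :=
  y + ((1 - y) ^+ n.+2 - y ^+ n.+2) / n.+2%:R.

Definition dflat_ends (R : realType) (n : nat) (y : R) : R :=
  1 - (1 - y) ^+ n.+1 - y ^+ n.+1.

Lemma is_derive_flat_ends (R : realType) (n : nat) (y : R) :
  is_derive y 1 (flat_ends n) (dflat_ends n y).
Proof.
pose p : {poly R} := 'X + n.+2%:R^-1 *: ((1 - 'X) ^+ n.+2 - 'X ^+ n.+2).
have -> : flat_ends n = horner p.
  by apply/funext => z; rewrite /flat_ends /p !hornerE mulrC.
have := is_derive_poly p y.
suff -> : (deriv p).[y] = dflat_ends n y by [].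
rewrite /p derivD derivZ derivB !deriv_exp derivB derivX (derivC 1) /=.
rewrite -(scaler_nat n.+2 ((0 - 1) * _)) -(scaler_nat n.+2 (1 * _)) -scalerBr.
rewrite scalerA mulVf ?pnatr_eq0// scale1r sub0r mulN1r mul1r /dflat_ends.
by rewrite !(hornerD, hornerN, horner_exp, hornerX, hornerC) addrA.
Qed.

Lemma exprn_01 (R : realType) (n : nat) (y : R) : 0 <= y <= 1 -> 0 <= y ^+ n <= 1.
Proof. by move=> /andP[y0 y1]; rewrite exprn_ge0// exprn_ile1. Qed.

Lemma onem_01 (R : realType) (y : R) : 0 <= y <= 1 -> 0 <= 1 - y <= 1.
Proof. lra. Qed.

Lemma flat_ends_dist (R : realType) (n : nat) (y : R) : 0 <= y <= 1 ->
  `|y - flat_ends n y| <= harmonic n.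
Proof.
move=> y01; rewrite /flat_ends opprD addNKr normrN normrM normfV normr_nat.
rewrite /harmonic/= ler_pdivrMr//.
have /andP[p0 p1] := exprn_01 n.+2 y01.
have /andP[q0 q1] := exprn_01 n.+2 (onem_01 y01).
apply: (@le_trans _ _ 1); first by rewrite ler_norml; apply/andP; split; lra.
by rewrite ler_pdivlMl// mulr1 ler_nat.
Qed.

Lemma cvg_flat_ends (R : realType) (y : R) : 0 <= y <= 1 -> flat_ends n y @[n --> \oo] --> y.
Proof.
move=> y01; apply/cvgrPdist_le => e e0.
have /cvgr0Pnorm_le/(_ e e0) := @cvg_harmonic R.
by apply: filterS => n /ler_normlW; apply: le_trans; exact: flat_ends_dist.
Qed.

Lemma norm_flat_ends (R : realType) (n : nat) (y : R) : 0 <= y <= 1 -> `|flat_ends n y| <= 2.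
Proof.
move=> y01; have := flat_ends_dist n y01.
have h1 : (harmonic n : R) <= 1 by rewrite /harmonic/= invf_le1// ler1n.
by rewrite !ler_norml => /andP[? ?]; apply/andP; split; lra.
Qed.

Lemma norm_dflat_ends (R : realType) (n : nat) (y : R) : 0 <= y <= 1 -> `|dflat_ends n y| <= 2.
Proof.
move=> y01; have /andP[p0 p1] := exprn_01 n.+1 y01.
have /andP[q0 q1] := exprn_01 n.+1 (onem_01 y01).
by rewrite /dflat_ends ler_norml; apply/andP; split; lra.
Qed.

Lemma dflat_ends0 (R : realType) n : dflat_ends n (0 : R) = 0.
Proof. by rewrite /dflat_ends subr0 expr1n exprS mul0r subr0 subrr. Qed.

Lemma dflat_ends1 (R : realType) n : dflat_ends n (1 : R) = 0.
Proof. by rewrite /dflat_ends subrr expr1n exprS mul0r subr0 subrr. Qed.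

Lemma cvg_dflat_ends (R : realType) (y : R) : 0 < y < 1 -> dflat_ends n y @[n --> \oo] --> (1 : R).
Proof.
move=> /andP[y0 y1].
have cvgX z : 0 < z -> z < 1 -> z ^+ n.+1 @[n --> \oo] --> (0 : R).
  move=> z0 z1; rewrite (cvg_shiftS (fun n => z ^+ n)); apply: cvg_expr.
  by rewrite ger0_norm// ltW.
rewrite -[X in _ --> X]subr0 -[X in _ --> X - _]subr0.
apply: cvgB; last exact: cvgX.
by apply: cvgB; [exact: cvg_cst|apply: cvgX; lra].
Qed.

Lemma is_derive_continuous (R : realType) (g : R -> R) (t d : R) :
  is_derive t 1 g d -> {for t, continuous g}.
Proof. by move=> [gd _]; apply: differentiable_continuous; apply/derivable1_diffP. Qed.

Lemma flat_ends_continuous (R : realType) n : continuous (@flat_ends R n).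
Proof. by move=> y; apply: is_derive_continuous; exact: is_derive_flat_ends. Qed.

Lemma dflat_ends_continuous (R : realType) n : continuous (@dflat_ends R n).
Proof.
move=> y; apply: cvgB; last exact: exprn_continuous.
apply: cvgB; first exact: cvg_cst.
have onemc : 1 - z @[z --> y] --> 1 - y by apply: cvgB; [exact: cvg_cst|exact: cvg_id].
exact: (cvg_comp _ _ onemc (@exprn_continuous _ n.+1 (1 - y))).
Qed.

(** * The weak derivative of a reflected path *)

(** Continuity is assumed on the whole line, so that the closed interval
    provides integrability. *)
Lemma continuous_integrable_oo (R : realType) (a b : R) (g : R -> R) :
  continuous g -> (@lebesgue_measure R).-integrable `]a, b[ (EFin \o g).
Proof.
move=> gc.
have iab : (@lebesgue_measure R).-integrable `[a, b] (EFin \o g).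
  apply: continuous_compact_integrable; first exact: segment_compact.
  exact: continuous_subspaceT.
by apply: integrableS iab => //; apply: subset_itv; rewrite bnd_simp.
Qed.

Lemma integral_derivative_oo (R : realType) (a b : R) (G g : R -> R) : a < b ->
  continuous G -> continuous g -> (forall t, a < t < b -> is_derive t 1 G (g t)) ->
  (\int[lebesgue_measure]_(t in `]a, b[) (g t)%:E = (G b - G a)%:E)%E.
Proof.
move=> ab Gc gc Gg.
rewrite -(@integral_itv_bndoo _ a b _ true false); last first.
  by apply/measurable_EFinP; apply: measurable_funTS; exact: continuous_measurable_fun.
rewrite EFinB; apply: continuous_FTC2 => //.
- exact: continuous_subspaceT.
- split=> [t|//|].
  + by rewrite in_itv/= => /Gg[].
  + by apply: cvg_at_right_filter; exact: Gc.
  + by apply: cvg_at_left_filter; exact: Gc.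
- by move=> t; rewrite in_itv/= derive1E => /Gg[].
Qed.

Definition path_speed (R : realType) (x f : R -> R) (t : R) : R :=
  if 0 < x t < 1 then f t else 0.

Lemma path_speed_measurable (R : realType) (x f : R -> R) :
  continuous x -> continuous f -> measurable_fun setT (path_speed x f).
Proof.
move=> xc fc; apply: measurable_fun_ifT => //; last exact: continuous_measurable_fun.
by apply: measurable_and; apply: measurable_fun_ltr => //; exact: continuous_measurable_fun.
Qed.

Lemma bounded_integrable_oo (R : realType) (a b M : R) (g : R -> R) :
  measurable_fun setT g -> (forall t, `|g t| <= M) ->
  (@lebesgue_measure R).-integrable `]a, b[ (EFin \o g).
Proof.
move=> gm gM; apply: measurable_bounded_integrable => //.
- by rewrite /= lebesgue_measure_itv/=; case: ifP => _ //; rewrite -EFinB ltry.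
- exact: measurable_funTS.
- exists M; split; first exact: num_real.
  by move=> M' MM' t _; apply: le_trans (gM t) (ltW MM').
Qed.

(** Integration by parts holds for each [flat_ends n] composed with x, which is
    of class C^1 on ]a, b[, and passes to the limit by dominated convergence.
    The integrability statements serve to sum the identity over the vertices. *)
Lemma path_weak_derivative (R : realType) (C B a b : R) (x f theta : R -> R) :
  0 <= C -> reflected_path C x f ->
  (forall s t, `|x t - x s| <= B * `|t - s|) -> continuous f ->
  0 <= a -> a < b -> (forall t, derivable theta t 1) ->
  continuous (derive1 theta) -> theta a = 0 -> theta b = 0 ->
  [/\ (@lebesgue_measure R).-integrable `]a, b[ (fun t => (x t * derive1 theta t)%:E),
     (@lebesgue_measure R).-integrable `]a, b[ (fun t => (path_speed x f t * theta t)%:E) &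
     \int[lebesgue_measure]_(t in `]a, b[) (x t * derive1 theta t) =
      - \int[lebesgue_measure]_(t in `]a, b[) (path_speed x f t * theta t)].
Proof.
move=> C0 xf x_lip fc a0 ab thd thc tha thb.
have xc := path_continuous x_lip.
have th_der (t : R) : is_derive t 1 theta (derive1 theta t).
  by apply: DeriveDef => //; rewrite derive1E.
have thetac : continuous theta by move=> t; exact: (is_derive_continuous (th_der t)).
(* [G n] is the derivative of flat_ends n (x) theta, which vanishes at a and b;
   [G'] is the limit of [G n]. *)
pose G n t := flat_ends n (x t) * derive1 theta t + dflat_ends n (x t) * f t * theta t.
pose G' t := x t * derive1 theta t + path_speed x f t * theta t.
have contM (g h : R -> R) : continuous g -> continuous h -> continuous (fun t => g t * h t).
  by move=> gc hc t; apply: cvgM; [exact: gc|exact: hc].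
have bxc n : continuous (fun t => flat_ends n (x t)).
  by move=> t; apply: continuous_comp; [exact: xc|exact: flat_ends_continuous].
have dbxc n : continuous (fun t => dflat_ends n (x t)).
  by move=> t; apply: continuous_comp; [exact: xc|exact: dflat_ends_continuous].
have Gc n : continuous (G n).
  move=> t; apply: cvgD; first exact: (contM _ _ (bxc n)).
  exact: (contM _ _ (contM _ _ (dbxc n) fc)).
have intG n : (\int[lebesgue_measure]_(t in `]a, b[) (G n t)%:E = 0)%E.
  pose H t := flat_ends n (x t) * theta t.
  have dH t : a < t < b -> is_derive t 1 H (G n t).
    move=> /andP[ta _].
    have t0 : 0 < t by exact: le_lt_trans ta.
    have bd : x t = 0 \/ x t = 1 -> dflat_ends n (x t) = 0.
      by case=> ->; [exact: dflat_ends0|exact: dflat_ends1].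
    have := path_derive_comp C0 xf x_lip fc t0 (is_derive_flat_ends n (x t)) bd.
    move=> /is_deriveM/(_ (th_der t)) /=.
    by move=> dG; apply: (is_derive_eq dG); rewrite /GRing.scale/= /G; ring.
  have Hc : continuous H by exact: contM.
  apply: (etrans (integral_derivative_oo ab Hc (Gc n) dH)).
  by rewrite /H tha thb !mulr0 subrr.
have intx : (@lebesgue_measure R).-integrable `]a, b[ (fun t => (x t * derive1 theta t)%:E).
  exact: (@continuous_integrable_oo R a b _ (contM _ _ xc thc)).
have mspeed : measurable_fun setT (path_speed x f) by exact: path_speed_measurable.
pose g t := 2 * `|derive1 theta t| + 2 * `|f t * theta t|.
have gc : continuous g.
  move=> t; apply: cvgD; apply: cvgM; try exact: cvg_cst; apply: cvg_norm; first exact: thc.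
  exact: contM.
have [] := @dominated_convergence _ _ _ (@lebesgue_measure R) `]a, b[ _
  (fun n t => (G n t)%:E) (fun t => (G' t)%:E) (fun t => (g t)%:E) => //.
- by move=> n; apply/measurable_EFinP; apply: measurable_funTS; exact: continuous_measurable_fun.
- apply/measurable_EFinP; apply: measurable_funTS; apply: measurable_funD.
    by apply: continuous_measurable_fun; exact: contM.
  by apply: measurable_funM => //; exact: continuous_measurable_fun.
- apply: aeW => t tab; apply: cvg_EFin; first exact: nearW.
  apply: cvgD.
    by apply: cvgM; [exact: (cvg_flat_ends (path_01 xf t))|exact: cvg_cst].
  apply: cvgM; last exact: cvg_cst.
  rewrite /path_speed; case: ifPn => x01.
    rewrite -[X in _ --> X]mul1r.
    by apply: cvgM; [exact: cvg_dflat_ends|exact: cvg_cst].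
  have bd : x t = 0 \/ x t = 1.
    have /andP[x0 x1] := path_01 xf t; move: x01.
    rewrite !lt_neqAle x0 x1 !andbT negb_and !negbK => /orP[/eqP<-|/eqP->]; first by left.
    by right.
  apply: cvg_near_cst; apply: nearW => n.
  by case: bd => ->; rewrite ?dflat_ends0 ?dflat_ends1 mul0r.
- exact: (@continuous_integrable_oo R a b g gc).
- apply: aeW => t n _; rewrite lee_fin /G /g.
  apply: (le_trans (ler_normD _ _)); rewrite -mulrA.
  rewrite !(normrM (flat_ends _ _), normrM (dflat_ends _ _)).
  apply: lerD; apply: ler_wpM2r => //.
    exact: norm_flat_ends (path_01 xf t).
  exact: norm_dflat_ends (path_01 xf t).
move=> iG' _ lim.
have G'0 : (\int[lebesgue_measure]_(t in `]a, b[) (G' t)%:E = 0)%E.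
  apply: (@cvg_unique _ (@ereal_hausdorff R) _ _ _ _ lim).
  by apply: cvg_near_cst; apply: nearW => n /=; rewrite intG.
have intS : (@lebesgue_measure R).-integrable `]a, b[ (fun t => (path_speed x f t * theta t)%:E).
  have := @integrableB _ _ _ (@lebesgue_measure R) `]a, b[ _ _ _ iG' intx.
  move=> /(_ (measurable_itv _)); apply: eq_integrable => // t _ /=.
  by rewrite /G' -EFinB addrAC subrr add0r.
split => //; apply/eqP; rewrite -addr_eq0 -RintegralD//; apply/eqP.
by rewrite /Rintegral; have := congr1 fine G'0.
Qed.

(** * Vertex functions *)

(** Sums over V serve as crude upper bounds for maxima over V. *)
Lemma lipschitz_field_bounded (R : realType) (V : finType)
    (F : (V -> R) -> V -> R) (K : R) : 0 <= K ->
  (forall u v i, `|F u i - F v i| <= K * \sum_j `|u j - v j|) ->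
  exists B, forall u, valued_in `[0, 1] u -> forall i, `|F u i| <= B.
Proof.
move=> K0 FK; exists (\sum_i `|F (fun=> 0) i| + K * #|V|%:R) => u u01 i.
rewrite -[F u i](subrK (F (fun=> 0) i)) addrC; apply: (le_trans (ler_normD _ _)).
apply: lerD.
  by rewrite (bigD1 i)//= lerDl sumr_ge0.
apply: (le_trans (FK _ _ _)); apply: ler_wpM2l => //.
rewrite -sum1_card natr_sum; apply: ler_sum => j _; rewrite subr0.
by have := u01 j; rewrite /= in_itv/= => /andP[? ?]; rewrite ger0_norm.
Qed.

Lemma laplacian_lipschitz (R : realType) (V : finType) (w : V -> V -> R) (r : R) :
  exists2 K, 0 <= K & forall u v i,
    `|laplacian w r u i - laplacian w r v i| <= K * \sum_j `|u j - v j|.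
Proof.
pose k i := `|degree w i `^ (- r)| * (\sum_j `|w i j| * 2).
have k0 i : 0 <= k i.
  by rewrite mulr_ge0// sumr_ge0// => j _; rewrite mulr_ge0.
exists (\sum_i k i) => [|u v i]; first by rewrite sumr_ge0.
set S := \sum_j `|u j - v j|.
have S0 : 0 <= S by rewrite sumr_ge0.
have uvS j : `|u j - v j| <= S by rewrite /S (bigD1 j)//= lerDl sumr_ge0.
apply: (@le_trans _ _ (k i * S)); last first.
  by apply: ler_wpM2r => //; rewrite (bigD1 i)//= lerDl sumr_ge0.
rewrite /laplacian -mulrBr normrM /k -mulrA; apply: ler_wpM2l => //.
rewrite -sumrB mulr_suml; apply: (le_trans (ler_norm_sum _ _ _)).
apply: ler_sum => j _; rewrite -mulrBr normrM -mulrA; apply: ler_wpM2l => //.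
have -> : u i - u j - (v i - v j) = (u i - v i) - (u j - v j) by ring.
apply: (le_trans (ler_normB _ _)); have := uvS i; have := uvS j; lra.
Qed.

Lemma integral_weighted_sum (R : realType) (I : eqType) (s : seq I) (a b : R)
    (g : I -> R -> R) (c : I -> R) :
  (forall i, (@lebesgue_measure R).-integrable `]a, b[ (fun t => (g i t)%:E)) ->
  (@lebesgue_measure R).-integrable `]a, b[ (fun t => (\sum_(i <- s) g i t * c i)%:E) /\
  \int[lebesgue_measure]_(t in `]a, b[) (\sum_(i <- s) g i t * c i) =
  \sum_(i <- s) (\int[lebesgue_measure]_(t in `]a, b[) g i t) * c i.
Proof.
move=> gi; elim: s => [|i s [IHi IHe]].
  split; last first.
    rewrite big_nil; under eq_Rintegral do rewrite big_nil.
    by rewrite Rintegral_cst// mul0r.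
  by apply: eq_integrable (integrable0 _ _) => // t _; rewrite big_nil.
have gci : (@lebesgue_measure R).-integrable `]a, b[ (fun t => (g i t * c i)%:E).
  have := @integrableZr _ _ _ (@lebesgue_measure R) `]a, b[ _ (c i) _ (gi i).
  by move=> /(_ (measurable_itv _)); exact: eq_integrable.
split.
  have := @integrableD _ _ _ (@lebesgue_measure R) `]a, b[ _ _ _ gci IHi.
  by move=> /(_ (measurable_itv _)); apply: eq_integrable => // t _; rewrite big_cons.
rewrite big_cons; under eq_Rintegral do rewrite big_cons.
by rewrite RintegralD// IHe RintegralZr//; exact: gi.
Qed.

Lemma innerV_ge0 (R : realType) (V : finType) (w : V -> V -> R) (r : R) (u : V -> R) :
  0 <= innerV w r u u.
Proof. by apply: sumr_ge0 => i _; rewrite mulr_ge0 ?powR_ge0// -expr2 sqr_ge0. Qed.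

Lemma normV_sqr (R : realType) (V : finType) (w : V -> V -> R) (r : R) (u : V -> R) :
  normV w r u ^+ 2 = innerV w r u u.
Proof. by rewrite sqr_sqrtr// innerV_ge0. Qed.

Lemma innerV_le (R : realType) (V : finType) (w : V -> V -> R) (r M : R) (u : V -> R) :
  (forall i, `|u i| <= M) -> innerV w r u u <= M ^+ 2 * \sum_i degree w i `^ r.
Proof.
move=> uM; rewrite mulr_sumr; apply: ler_sum => i _.
apply: ler_wpM2r; first exact: powR_ge0.
by rewrite -expr2 -real_normK ?num_real// lerXn2r// ?nnegrE//; apply: le_trans (uM i).
Qed.

Lemma L2_bounded (R : realType) (V : finType) (w : V -> V -> R) (r a b M : R)
    (u : R -> V -> R) :
  (forall i, measurable_fun setT (fun t => u t i)) ->
  (forall t i, `|u t i| <= M) -> L2 w r `]a, b[ u.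
Proof.
move=> um uM; split=> [i|]; first exact: measurable_funTS.
have intu : (@lebesgue_measure R).-integrable `]a, b[ (fun t => (innerV w r (u t) (u t))%:E).
  apply: (@bounded_integrable_oo _ _ _ (M ^+ 2 * \sum_i degree w i `^ r)).
    apply: measurable_sum => i; apply: measurable_funM => //.
    exact: measurable_funM.
  by move=> t; rewrite ger0_norm ?innerV_ge0// innerV_le.
under eq_integral do rewrite normV_sqr.
exact: integrable_lty.
Qed.

Lemma lipschitzV_of_components (R : realType) (V : finType) (w : V -> V -> R) (r B : R)
    (T : set R) (u : R -> V -> R) :
  (forall i s t, `|u t i - u s i| <= B * `|t - s|) -> lipschitzV w r T u.
Proof.
move=> uB; exists (Num.sqrt (B ^+ 2 * \sum_i degree w i `^ r)) => s t _ _.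
rewrite -[X in _ * X]normr_id -[X in _ * X]sqrtr_sqr -sqrtrM; last first.
  by rewrite mulr_ge0 ?sqr_ge0// sumr_ge0// => i _; exact: powR_ge0.
apply: ler_wsqrtr.
by have := innerV_le w r (fun i => uB i t s); rewrite exprMn mulrAC.
Qed.

(** The inner product is diagonal, so the identity is the weighted sum of
    the scalar ones; the support condition makes a test function vanish at both
    end points. *)
Lemma projected_flow_weak_derivative (R : realType) (V : finType)
    (w : V -> V -> R) (r C B : R) (u f : R -> V -> R) (a b : R) :
  0 <= C -> (forall i, reflected_path C (fun t => u t i) (fun t => f t i)) ->
  (forall i s t, `|u t i - u s i| <= B * `|t - s|) ->
  (forall i, continuous (fun t => f t i)) -> 0 <= a -> a < b ->
  weak_derivative w r `]a, b[ u
    (fun t i => path_speed (fun t => u t i) (fun t => f t i) t).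
Proof.
move=> C0 uf ulip fc a0 ab phi [phi_smooth _ supp].
have phi0 t i : ~ `]a, b[%classic t -> phi t i = 0.
  move=> tab; apply: contrapT => phit; apply: tab; apply: supp.
  by apply: subset_closure; exists i.
have parts i := @path_weak_derivative R C B a b (fun t => u t i) (fun t => f t i)
  (fun t => phi t i) C0 (uf i) (ulip i) (fc i) a0 ab.
have {}parts i : [/\ _, _ & _] := parts i (phi_smooth i 0%N)
  (fun t => differentiable_continuous (iffLR (derivable1_diffP _ _) (phi_smooth i 1%N t)))
  (phi0 a i _) (phi0 b i _).
have aN : ~ `]a, b[%classic a by rewrite /= in_itv/= ltxx.
have bN : ~ `]a, b[%classic b by rewrite /= in_itv/= ltxx andbF.
have int1 i := let: And3 h _ _ := parts aN bN i in h.
have int2 i := let: And3 _ h _ := parts aN bN i in h.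
have intE i := let: And3 _ _ h := parts aN bN i in h.
have [_ sum1] := integral_weighted_sum (index_enum V) (fun i => degree w i `^ r) int1.
have [_ sum2] := integral_weighted_sum (index_enum V) (fun i => degree w i `^ r) int2.
rewrite /innerV [LHS]sum1 [X in - X]sum2 -sumrN; apply: eq_bigr => i _.
by rewrite intE mulNr.
Qed.

(** * Existence of the double-obstacle flow *)

Theorem theorem3p6 (R : realType) (V : finType) (E : rel V) (w : V -> V -> R)
    (r eps : R) (T := `[0, +oo[%classic : set R) :
  weighted_graph E w -> 0 <= r <= 1 -> 0 < eps ->
  forall u0 : V -> R, valued_in `[0, 1] u0 ->
  exists (u beta : R -> V -> R),
    [/\ forall t, T t -> valued_in `[0, 1] (u t),
        H1_loc w r T u,
        lipschitzV w r T u,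
        u 0 = u0
      & exists du : R -> V -> R,
          weak_derivative_loc w r T u du /\
          {ae @lebesgue_measure R, forall t, T t ->
             (forall i, eps * du t i + eps * laplacian w r (u t) i
                        + 2^-1 - u t i = beta t i)
             /\ subdiffB (u t) (beta t)}].
Proof.
move=> _ _ eps0 u0 u01.
pose F (u : V -> R) i := eps^-1 * (u i - 2^-1) - laplacian w r u i.
have [L L0 lapL] := laplacian_lipschitz w r.
have epsV0 : 0 <= eps^-1 by rewrite invr_ge0 ltW.
pose K := eps^-1 + L.
have K0 : 0 <= K by rewrite addr_ge0.
have FK u v i : `|F u i - F v i| <= K * \sum_j `|u j - v j|.
  have -> : F u i - F v i =
      eps^-1 * (u i - v i) - (laplacian w r u i - laplacian w r v i).
    by rewrite /F; ring.
  rewrite mulrDl; apply: (le_trans (ler_normB _ _)); apply: lerD => //.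
  rewrite normrM ger0_norm//; apply: ler_wpM2l => //.
  by rewrite (bigD1 i)//= lerDl sumr_ge0.
have [B FB] := lipschitz_field_bounded K0 FK.
have [u [u_init ulip path]] := projected_flow_exists FB K0 FK u01.
have uv01 t : valued_in `[0, 1] (u t).
  by move=> i; rewrite /= in_itv/=; exact: path_01 (path i) t.
have uc i : continuous (fun t => u t i) by exact: path_continuous (ulip i).
have fc i : continuous (fun t => F (u t) i).
  move=> t; apply: cvgB.
    by apply: cvgM; [exact: cvg_cst|apply: cvgB; [exact: uc|exact: cvg_cst]].
  apply: cvgM; first exact: cvg_cst.
  apply: cvg_big => [|j _]; first exact: (@add_continuous R).
  by apply: cvgM; [exact: cvg_cst|apply: cvgB; exact: uc].
pose du t i := path_speed (fun t => u t i) (fun t => F (u t) i) t.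
have u_L2 a b : L2 w r `]a, b[ u.
  apply: (@L2_bounded _ _ _ _ _ _ 1) => [i|t i]; first exact: continuous_measurable_fun.
  by have /andP[? ?] := path_01 (path i) t; rewrite ger0_norm.
have du_L2 a b : L2 w r `]a, b[ du.
  apply: (@L2_bounded _ _ _ _ _ _ B) => [i|t i]; first exact: path_speed_measurable.
  rewrite /du /path_speed; case: ifP => _; first exact: FB.
  by rewrite normr0; exact: le_trans (FB _ (uv01 t) i).
(* [B] bounds a family indexed by V, so its sign is known only for V
   inhabited. *)
have i0 : V -> 0 <= B by move=> i; exact: le_trans (FB _ u01 i).
have C_ge0 : 0 <= K * #|V|%:R * B.
  case: (pickP (fun _ : V => true)) => [i _|V0]; last by rewrite eq_card0// mulr0 mul0r.
  by rewrite !mulr_ge0// (i0 i).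
have du_weak a b : 0 <= a -> a < b -> weak_derivative w r `]a, b[ u du.
  by move=> a0 ab; exact: (@projected_flow_weak_derivative _ _ w r _ _ u
    (fun t => F (u t)) a b C_ge0 path ulip fc a0 ab).
exists u, (fun t i => eps * du t i + eps * laplacian w r (u t) i + 2^-1 - u t i).
split=> //.
- move=> a b; rewrite /T /= !in_itv/= !andbT => a0 b0 ab; split=> //.
  by exists du; split=> //; exact: du_weak.
- exact: lipschitzV_of_components ulip.
exists du; split.
  move=> a b; rewrite /T /= !in_itv/= !andbT => a0 b0 ab; split=> //.
  exact: du_weak.
(* Time 0 is excluded: if u0 touches an obstacle while F points inwards,
   the sign condition on beta fails there. *)
have null0 : (@lebesgue_measure R).-negligible [set (0 : R)].
  by exists [set 0]; split; [exact: measurable_set1|exact: lebesgue_measure_set1|].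
apply: negligibleS null0 => t /= nPt; apply: contrapT => t0; apply: nPt => Tt.
have {Tt t0} t0 : 0 < t.
  move: Tt; rewrite /T /= in_itv/= andbT le_eqVlt => /orP[/eqP t0'|//].
  by case: t0.
split=> // i.
have -> : eps * du t i + eps * laplacian w r (u t) i + 2^-1 - u t i =
          eps * (du t i - F (u t) i).
  by rewrite /F; field; rewrite gt_eqF.
rewrite /du /path_speed; split=> [ut|->|ut].
- rewrite ut ltxx/= sub0r; apply: mulr_ge0; first exact: ltW.
  rewrite oppr_ge0; exact: (path_at0 C_ge0 (path i) (fc i) t0 ut).
- by rewrite subrr mulr0.
- rewrite ut ltxx andbF sub0r mulrN oppr_le0; apply: mulr_ge0; first exact: ltW.
  exact: (path_at1 C_ge0 (path i) (fc i) t0 ut).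
Qed.
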